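(* (i) A finite connected graph is a partial cube if and only if it can be obtained from the one-vertex graph $K_1$ by a (finite, possibly empty) sequence of expansions. (ii) For a finite partial cube $G$, the number of expansions needed to produce $G$ from $K_1$ is $\dim_I(G)$.
   Context: Graphs are simple, undirected and nonempty. For a set $X$, the hypercube $\mathcal H(X)$ is the graph whose vertices are the finite subsets of $X$, with $P,Q$ adjacent iff $|P\Delta Q|=1$; its dimension is $|X|$. A graph is a partial cube if it can be isometrically embedded (i.e. by a map preserving shortest-path distances) into some $\mathcal H(X)$. The isometric dimension $\dim_I(G)$ of a partial cube $G$ is the minimum possible dimension of a hypercube into which $G$ is isometrically embeddable. A subgraph $H$ of a connected graph $G$ is isometric if $d_H(a,b)=d_G(a,b)$ for all vertices $a,b$ of $H$. Expansion: let $G=(V,E)$ be a connected graph and let $G_1=(V_1,E_1)$, $G_2=(V_2,E_2)$ be two nonempty isometric subgraphs of $G$ with $G=G_1\cup G_2$ (i.e. $V=V_1\cup V_2$, $E=E_1\cup E_2$). The expansion of $G$ with respect to $G_1$ and $G_2$ is the graph with vertex set $V'_1\cup V'_2$, where $V'_i=\{x^i=(i,x):x\in V_i\}$, whose edges are $x^iy^i$ for $xy\in E_i$ ($i=1,2$) together with the edges $x^1x^2$ for $x\in V_1\cap V_2$. Graphs are considered up to isomorphism. In (ii), the number of expansions needed is the minimum length of a sequence of expansions leading from $K_1$ to $G$. *)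

(* Defs.v *)
From HB Require Import structures.
From mathcomp Require Import all_boot finmap.
From mathcomp Require Import boolp classical_sets functions cardinality.

Set Implicit Arguments.
Unset Strict Implicit.
Unset Printing Implicit Defensive.

Local Open Scope classical_set_scope.
Local Open Scope nat_scope.
Local Open Scope card_scope.

Definition is_minimum (P : nat -> Prop) (n : nat) : Prop :=
  P n /\ forall m, P m -> n <= m.

(* Vertex sets may be infinite, as needed for hypercubes on infinite sets.
   Carriers are choiceTypes so that sets of vertices can be formed with
   finmap; classically this is no restriction. *)
Record sgraph := SGraph {
  vertex :> choiceType;
  adj : rel vertex;
  adj_sym : symmetric adj;
  adj_irrefl : irreflexive adj;
  vertex_nonempty : inhabited vertex }.

Arguments adj {s}.

Definition walk_length (G : sgraph) (x y : G) (n : nat) : Prop :=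
  exists p : seq G, [/\ path adj x p, last x p = y & size p = n].

Definition connected (G : sgraph) : Prop :=
  forall x y : G, exists n, walk_length x y n.

Definition finite_graph (G : sgraph) : Prop := finite_set [set: G].

(* d_G(x, y) = n.  The relation holds for no n when x and y lie in different
   components. *)
Definition dist (G : sgraph) (x y : G) : nat -> Prop :=
  is_minimum (walk_length x y).

Definition isometry (G H : sgraph) (f : G -> H) : Prop :=
  forall x y n, dist x y n <-> dist (f x) (f y) n.

Definition isometrically_embeddable (G H : sgraph) : Prop :=
  exists f : G -> H, isometry f.

Definition isomorphic (G H : sgraph) : Prop :=
  exists2 f : G -> H, bijective f & forall x y, adj (f x) (f y) = adj x y.

Definition symdiff (X : choiceType) (P Q : {fset X}) : {fset X} :=
  ((P `\` Q) `|` (Q `\` P))%fset.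

Definition hypercube_adj (X : choiceType) : rel {fset X} :=
  fun P Q => #|` symdiff P Q| == 1.

Lemma hypercube_adj_sym (X : choiceType) : symmetric (@hypercube_adj X).
Proof. by move=> P Q; rewrite /hypercube_adj /symdiff fsetUC. Qed.

Lemma hypercube_adj_irrefl (X : choiceType) : irreflexive (@hypercube_adj X).
Proof.
by move=> P; rewrite /hypercube_adj /symdiff fsetDv fsetU0 cardfs0.
Qed.

Definition hypercube (X : choiceType) : sgraph :=
  SGraph (@hypercube_adj_sym X) (@hypercube_adj_irrefl X)
    (inhabits (fset0 : {fset X})).

Definition partial_cube (G : sgraph) : Prop :=
  exists X : choiceType, isometrically_embeddable G (hypercube X).

(* dim_I(G) = d, for a natural number d.  The minimum is over the cardinalities
   of all sets X, infinite ones included. *)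
Definition isometric_dimension (G : sgraph) (d : nat) : Prop :=
  (exists X : choiceType,
     ([set: X] #= `I_d) /\ isometrically_embeddable G (hypercube X)) /\
  (forall X : choiceType,
     isometrically_embeddable G (hypercube X) -> `I_d #<= [set: X]).

(* Not necessarily induced. *)
Record subgraph (G : sgraph) := Subgraph {
  sub_vertex : pred G;
  sub_edge : rel G;
  sub_edge_sym : symmetric sub_edge;
  sub_edge_adj : forall x y, sub_edge x y -> adj x y;
  sub_edge_vertex : forall x y, sub_edge x y -> sub_vertex x && sub_vertex y;
  sub_vertex_nonempty : exists x, sub_vertex x }.

Section SubgraphAsGraph.
Variables (G : sgraph) (H : subgraph G).

Definition sub_carrier : choiceType := {x : G | sub_vertex H x}.

Definition sub_adj : rel sub_carrier := fun x y => sub_edge H (val x) (val y).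

Lemma sub_adj_sym : symmetric sub_adj.
Proof. by move=> x y; rewrite /sub_adj sub_edge_sym. Qed.

Lemma sub_adj_irrefl : irreflexive sub_adj.
Proof.
move=> x; apply/negP => /sub_edge_adj; by rewrite adj_irrefl.
Qed.

Lemma sub_carrier_nonempty : inhabited sub_carrier.
Proof. by have [x Hx] := sub_vertex_nonempty H; exists; exists x. Qed.

Definition graph_of_subgraph : sgraph :=
  SGraph sub_adj_sym sub_adj_irrefl sub_carrier_nonempty.

Definition isometric_subgraph : Prop :=
  @isometry graph_of_subgraph G (fun x => val x).

End SubgraphAsGraph.

Coercion graph_of_subgraph : subgraph >-> sgraph.

Definition is_union (G : sgraph) (G1 G2 : subgraph G) : Prop :=
  (forall x : G, sub_vertex G1 x || sub_vertex G2 x) /\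
  (forall x y : G, adj x y = sub_edge G1 x y || sub_edge G2 x y).

Section Expansion.
Variables (G : sgraph) (G1 G2 : subgraph G).

(* inl x and inr x are the copies (1, x) and (2, x) of the vertex x. *)
Definition expansion_carrier : choiceType := (G1 + G2)%type.

Definition expansion_adj : rel expansion_carrier := fun u v =>
  match u, v with
  | inl x, inl y => adj (s := G1) x y
  | inr x, inr y => adj (s := G2) x y
  | inl x, inr y => val x == val y
  | inr x, inl y => val x == val y
  end.

Lemma expansion_adj_sym : symmetric expansion_adj.
Proof. by case=> x [] y /=; first [exact: sub_adj_sym | exact: eq_sym]. Qed.

Lemma expansion_adj_irrefl : irreflexive expansion_adj.
Proof. by case=> x /=; exact: sub_adj_irrefl. Qed.

Lemma expansion_nonempty : inhabited expansion_carrier.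
Proof. by have [x] := vertex_nonempty G1; exists; left. Qed.

Definition expansion : sgraph :=
  SGraph expansion_adj_sym expansion_adj_irrefl expansion_nonempty.

End Expansion.

Definition is_expansion (G G' : sgraph) : Prop :=
  connected G /\
  exists G1 G2 : subgraph G,
    [/\ isometric_subgraph G1, isometric_subgraph G2, is_union G1 G2
      & isomorphic (expansion G1 G2) G'].

Definition K1 : sgraph :=
  @SGraph unit (fun _ _ => false) (fun _ _ => erefl) (fun _ => erefl)
    (inhabits tt).

Inductive obtained_from_K1 : nat -> sgraph -> Prop :=
| obtained_K1 (G : sgraph) : isomorphic K1 G -> obtained_from_K1 0 G
| obtained_expansion (n : nat) (G G' : sgraph) :
    obtained_from_K1 n G -> is_expansion G G' -> obtained_from_K1 n.+1 G'.

Definition expansion_number (G : sgraph) : nat -> Prop :=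
  is_minimum (fun n => obtained_from_K1 n G).

(* Main.v *)
(** A finite graph is a partial cube iff its vertices can be labelled by 0/1
    words of some length n so that graph distance is Hamming distance; the least
    such n is the isometric dimension.  An expansion of a graph labelled by words
    of length n is labelled by words of length n+1, the new letter telling the
    two copies apart.  Conversely, if a letter of a labelling takes both values,
    deleting it yields a labelled graph H; the words of H that extend by 0,
    respectively by 1, span isometric subgraphs, and the given graph is the
    expansion of H along them.  Hence a graph with words of length n needs at
    most n expansions, and one obtained by n expansions has words of length n.

    All distance computations rest on a local criterion: labels are isometric as
    soon as adjacent vertices have labels at Hamming distance at most 1 and each
    vertex has a neighbour strictly closer, in Hamming distance, to any other
    given vertex. *)

Require Import Defs.
From mathcomp Require Import all_boot finmap.
From mathcomp Require Import boolp classical_sets functions cardinality.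

Set Implicit Arguments.
Unset Strict Implicit.
Unset Printing Implicit Defensive.

Local Open Scope nat_scope.

(** * Distances *)

Lemma dist_uniq (G : sgraph) (x y : G) m n : dist x y m -> dist x y n -> m = n.
Proof.
by move=> [wm lm] [wn ln]; apply/eqP; rewrite eqn_leq lm // ln.
Qed.

Lemma dist0_eq (G : sgraph) (x y : G) : dist x y 0 -> x = y.
Proof. by case=> -[p [_ + /size0nil p0]] _; rewrite p0. Qed.

Lemma adj_dist1 (G : sgraph) (x y : G) : adj x y <-> dist x y 1.
Proof.
split=> [xy|[[[|z [|? ?]] []]]] //=; last by rewrite andbT => xz <-.
split; first by exists [:: y]; rewrite /= xy.
case=> // -[p [_ + /size0nil p0]]; rewrite p0 /= => xEy.
by rewrite xEy adj_irrefl in xy.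
Qed.

Lemma dist_step (G : sgraph) (x y : G) n :
  dist x y n.+1 -> exists2 z, adj x z & dist z y n.
Proof.
case=> [] [] [|z p] [] //= /andP[xz zp] lp [sp] minxy; exists z => //.
split; first by exists p.
move=> m [q [zq lq sq]]; rewrite -ltnS; apply: minxy.
by exists (z :: q); rewrite /= xz sq.
Qed.

(** Along an edge [m] drops by at most one, so no walk is shorter than [m x y]; descending steps
    therefore drop it by exactly one and build a walk of that length. *)
Lemma dist_from_steps (G : sgraph) (m : G -> G -> nat) :
    (forall x, m x x = 0) ->
    (forall x y z, adj x z -> m x y <= (m z y).+1) ->
    (forall x y, x <> y -> exists2 z, adj x z & m z y < m x y) ->
  forall x y, dist x y (m x y).
Proof.
move=> m0 mS step x y; split=> [|k [p []]]; last first.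
  elim: p k x => [|z p IH] [|k] x //=; first by move=> _ ->; rewrite m0.
  case/andP=> xz zp lp [sp]; apply: leq_trans (mS _ _ _ xz) _; exact: IH.
have [k] := ubnP (m x y); elim: k x => // k IH x.
have [<- _|/eqP/step[z xz zy]] := eqVneq x y; first by rewrite m0; exists [::].
rewrite ltnS => xk; have [p [zp lp sp]] := IH z (leq_trans zy xk).
exists (z :: p); split=> /=; [by rewrite xz|by []|].
by apply/eqP; rewrite eqn_leq sp zy mS.
Qed.

(** * Finite cubes *)

Notation cube n := {ffun 'I_n -> bool}.

Definition hamming n (u v : cube n) : nat := \sum_(i < n) (u i != v i).

Definition cube_cons n (b : bool) (u : cube n) : cube n.+1 :=
  [ffun i => if unlift ord0 i is Some j then u j else b].

Definition cube_behead n (u : cube n.+1) : cube n := [ffun j => u (lift ord0 j)].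

Lemma cube_cons_eta n (u : cube n.+1) : u = cube_cons (u ord0) (cube_behead u).
Proof. by apply/ffunP=> i; rewrite ffunE; case: unliftP => [j|] -> //; rewrite ffunE. Qed.

Lemma hammingxx n (u : cube n) : hamming u u = 0.
Proof. by rewrite /hamming big1 // => i _; rewrite eqxx. Qed.

Lemma hamming_sym n (u v : cube n) : hamming u v = hamming v u.
Proof. by apply: eq_bigr => i _; rewrite eq_sym. Qed.

Lemma hamming_triangle n (u v w : cube n) :
  hamming u w <= hamming u v + hamming v w.
Proof.
rewrite -big_split; apply: leq_sum => i _ /=.
by case: (u i) (v i) (w i) => [] [] [].
Qed.

Lemma hamming0_eq n (u v : cube n) : hamming u v = 0 -> u = v.
Proof.
move/eqP; rewrite sum_nat_eq0 => /forallP uv; apply/ffunP=> i.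
by have := uv i; rewrite eqb0 negbK => /eqP.
Qed.

Lemma hamming_cons n b c (u v : cube n) :
  hamming (cube_cons b u) (cube_cons c v) = (b != c) + hamming u v.
Proof.
rewrite /hamming big_ord_recl !ffunE unlift_none; congr (_ + _).
by apply: eq_bigr => i _; rewrite !ffunE liftK.
Qed.

(** Asserting that the distance exists makes this include connectedness of [G]. *)
Definition cube_embedding (G : sgraph) n (f : G -> cube n) : Prop :=
  forall x y, dist x y (hamming (f x) (f y)).

Definition cube_embeddable (n : nat) (G : sgraph) : Prop :=
  exists f : G -> cube n, cube_embedding f.

Section CubeEmbedding.
Variables (G : sgraph) (n : nat) (f : G -> cube n).

Lemma cube_embedding_from_steps :
    (forall x y, adj x y -> hamming (f x) (f y) <= 1) ->
    (forall x y, x <> y ->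
       exists2 z, adj x z & hamming (f z) (f y) < hamming (f x) (f y)) ->
  cube_embedding f.
Proof.
move=> f1 step; apply: dist_from_steps => // [x|x y z xz]; first exact: hammingxx.
apply: leq_trans (hamming_triangle _ (f z) _) _.
by rewrite -add1n leq_add2r f1.
Qed.

Hypothesis fE : cube_embedding f.

Lemma cube_embedding_inj : injective f.
Proof. by move=> x y fxy; apply: dist0_eq; rewrite -(hammingxx (f y)) -{1}fxy. Qed.

Lemma cube_embedding_adj x y : adj x y = (hamming (f x) (f y) == 1).
Proof.
apply/idP/eqP => [/adj_dist1|h1]; first exact: dist_uniq.
by apply/adj_dist1; rewrite -h1.
Qed.

Lemma cube_embedding_step x y : x <> y ->
  exists2 z, hamming (f x) (f z) = 1 & hamming (f z) (f y) < hamming (f x) (f y).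
Proof.
have := fE x y; case: (hamming (f x) (f y)) => [/dist0_eq //|m].
move=> /dist_step[z xz zy] _; exists z.
  by apply/eqP; rewrite -cube_embedding_adj.
by rewrite (dist_uniq (fE z y) zy).
Qed.

Lemma cube_embedding_connected : connected G.
Proof. by move=> x y; have [w _] := fE x y; exists (hamming (f x) (f y)). Qed.

(** Lets isometric subgraphs be handled through restricted labels: distances in [G] exist and are
    unique. *)
Lemma cube_embedding_isometry (H : sgraph) (h : H -> G) :
  isometry h <-> cube_embedding (fun x => f (h x)).
Proof.
split=> [hI x y|hE x y k]; first by apply/hI.
by split=> hk; [rewrite (dist_uniq hk (hE x y))|rewrite (dist_uniq hk (fE (h x) (h y)))].
Qed.

End CubeEmbedding.

(** Labels determine both vertices and adjacency, so a graph is known up to isomorphism from its set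
    of labels. *)
Lemma cube_embedding_isomorphic (G H : sgraph) n (f : G -> cube n) (g : H -> cube n) :
    cube_embedding f -> cube_embedding g ->
    (forall x, exists y, g y = f x) -> (forall y, exists x, f x = g y) ->
  isomorphic G H.
Proof.
move=> fE gE /choice[h hK] /choice[k kK]; exists h.
  exists k => x; [apply: (cube_embedding_inj fE)|apply: (cube_embedding_inj gE)].
    by rewrite kK hK.
  by rewrite hK kK.
by move=> x y; rewrite (cube_embedding_adj fE) (cube_embedding_adj gE) !hK.
Qed.

Lemma cube_embeddable_isomorphic (G H : sgraph) n :
  isomorphic G H -> cube_embeddable n G -> cube_embeddable n H.
Proof.
move=> [h [k hK kK] hadj] [f fE]; exists (fun x => f (k x)).
apply: cube_embedding_from_steps => [x y|x y xy].
  by rewrite -{1}(kK x) -{1}(kK y) hadj (cube_embedding_adj fE) => /eqP->.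
have /(cube_embedding_step fE)[z xz zy] : k x <> k y.
  by move=> kxy; apply: xy; rewrite -(kK x) kxy kK.
exists (h z); last by rewrite hK.
by rewrite -(kK x) hadj (cube_embedding_adj fE) xz.
Qed.

(** * Expansions *)

Section EmbedExpansion.
Variables (G : sgraph) (G1 G2 : subgraph G).
Hypotheses (G1I : isometric_subgraph G1) (G2I : isometric_subgraph G2).
Hypothesis G12 : is_union G1 G2.
Variables (n : nat) (f : G -> cube n).
Hypothesis fE : cube_embedding f.

Definition expansion_label (u : expansion G1 G2) : cube n.+1 :=
  match u with
  | inl x => cube_cons false (f (val x))
  | inr x => cube_cons true (f (val x))
  end.

Lemma expansion_label_step (u v : expansion G1 G2) : u <> v ->
  exists2 w, adj u w &
    hamming (expansion_label w) (expansion_label v)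
      < hamming (expansion_label u) (expansion_label v).
Proof.
have E1 := (cube_embedding_isometry fE _).1 G1I.
have E2 := (cube_embedding_isometry fE _).1 G2I.
have [_ Eun] := G12.
case: u v => x [] y xy /=.
- have /(cube_embedding_step E1)[z xz zy] : x <> y by move=> e; apply: xy; rewrite e.
  have {}xz : @adj G1 x z by rewrite (cube_embedding_adj E1) xz.
  by exists (inl z) => //=; rewrite !hamming_cons.
(* If [x] has a twin in the other copy, crossing to it corrects the new letter. Otherwise a geodesic
   step of [G] is used: its edge must belong to [G1], since [x] is not in [G2]. *)
- have [x2|x2] := boolP (sub_vertex G2 (val x)).
    exists (inr (exist _ (val x) x2)); first by rewrite /= eqxx.
    by rewrite /= !hamming_cons /= ltnS.
  have /(cube_embedding_step fE)[z xz zy] : val x <> val y.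
    by move=> e; move: x2; rewrite e; case: (y) => y' /= ->.
  have /orP[xz1|/sub_edge_vertex/andP[]] : sub_edge G1 (val x) z || sub_edge G2 (val x) z.
  + by rewrite -Eun (cube_embedding_adj fE) xz.
  + have /andP[_ z1] := sub_edge_vertex xz1.
    by exists (inl (exist _ z z1)) => //=; rewrite !hamming_cons.
  + by rewrite (negbTE x2).
- have [x1|x1] := boolP (sub_vertex G1 (val x)).
    exists (inl (exist _ (val x) x1)); first by rewrite /= eqxx.
    by rewrite /= !hamming_cons /= ltnS.
  have /(cube_embedding_step fE)[z xz zy] : val x <> val y.
    by move=> e; move: x1; rewrite e; case: (y) => y' /= ->.
  have /orP[/sub_edge_vertex/andP[]|xz2] : sub_edge G1 (val x) z || sub_edge G2 (val x) z.
  + by rewrite -Eun (cube_embedding_adj fE) xz.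
  + by rewrite (negbTE x1).
  + have /andP[_ z2] := sub_edge_vertex xz2.
    by exists (inr (exist _ z z2)) => //=; rewrite !hamming_cons.
- have /(cube_embedding_step E2)[z xz zy] : x <> y by move=> e; apply: xy; rewrite e.
  have {}xz : @adj G2 x z by rewrite (cube_embedding_adj E2) xz.
  by exists (inr z) => //=; rewrite !hamming_cons.
Qed.

Lemma expansion_label_embedding : cube_embedding expansion_label.
Proof.
apply: cube_embedding_from_steps; last exact: expansion_label_step.
by case=> x [] y /=; rewrite hamming_cons /=;
  [move/sub_edge_adj|move/eqP->|move/eqP->|move/sub_edge_adj];
  rewrite ?hammingxx // (cube_embedding_adj fE) => /eqP->.
Qed.

End EmbedExpansion.

Lemma cube_embeddable_expansion n (G G' : sgraph) :
  is_expansion G G' -> cube_embeddable n G -> cube_embeddable n.+1 G'.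
Proof.
move=> [_ [G1 [G2 [G1I G2I G12 iso]]]] [f fE].
apply: cube_embeddable_isomorphic iso _.
by exists (expansion_label f); exact: expansion_label_embedding.
Qed.

Lemma obtained_cube_embeddable n (G : sgraph) :
  obtained_from_K1 n G -> cube_embeddable n G.
Proof.
elim=> {n G} [G iso|n G G' _ GE exp]; last exact: cube_embeddable_expansion exp GE.
apply: cube_embeddable_isomorphic iso _; exists (fun=> [ffun=> false]).
by apply: cube_embedding_from_steps => // -[] [].
Qed.

(** * Contractions *)

Section Contraction.
Variables (G : sgraph) (n : nat) (f : G -> cube n.+1).
Hypothesis fE : cube_embedding f.

(** [half false] and [half true] become the vertex sets of the two subgraphs along which [G] is
    recovered. *)
Definition half (b : bool) (u : cube n) : bool :=
  `[< exists x, f x = cube_cons b u >].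

Lemma half_step b c (u v : cube n) :
    half b u -> half c v -> cube_cons b u <> cube_cons c v ->
  exists d w, [/\ half d w, (b != d) + hamming u w = 1
    & (d != c) + hamming w v < (b != c) + hamming u v].
Proof.
move=> /asboolP[x fx] /asboolP[y fy]; rewrite -hamming_cons -fx -fy => fxy.
have /(cube_embedding_step fE)[z xz zy] : x <> y by move=> e; apply: fxy; rewrite e.
exists (f z ord0), (cube_behead (f z)).
rewrite -!hamming_cons -cube_cons_eta -fx -fy; split=> //.
by apply/asboolP; exists z; exact: cube_cons_eta.
Qed.

(** When the first letters agree, a step changing the first letter would keep the tail and increase
    the distance, so a descending step stays in the half. *)
Lemma half_same b (u v : cube n) : half b u -> half b v -> u <> v ->
  exists w, [/\ half b w, hamming u w = 1 & hamming w v < hamming u v].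
Proof.
move=> bu bv uv; have [|d [w [dw]]] := half_step bu bv.
  move=> e; apply: uv; apply: hamming0_eq.
  by have := hamming_cons b b u v; rewrite e hammingxx eqxx.
have [-> | bd] := eqVneq b d; first by rewrite eqxx => uw wv; exists w; rewrite dw.
rewrite eqxx !add1n => -[/hamming0_eq <-].
by rewrite ltnNge leqnSn.
Qed.

(* If [u] does not extend by [~~ b], a geodesic of [G] from the label [b :: u] to
   [~~ b :: v] cannot change its first letter at the first step. *)
Lemma half_cross b (u v : cube n) : half b u -> half (~~ b) v ->
  half (~~ b) u \/
  exists w, [/\ half b w, hamming u w = 1 & hamming w v < hamming u v].
Proof.
move=> bu bv; have [|d [w [dw]]] := half_step bu bv.
  by move=> /ffunP/(_ ord0); rewrite !ffunE unlift_none; case: (b).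
case: (eqVneq b d) dw => [<-|bd] dw.
  by rewrite ltn_add2l => uw wv; right; exists w.
have db : d = ~~ b by case: (b) (d) bd => [] [].
by case=> /hamming0_eq uw _; left; rewrite uw -db.
Qed.

Definition contraction_carrier : choiceType :=
  {u : cube n | half false u || half true u}.

(** Adjacency is read off the labels; that each such edge comes from one of the halves is the
    content of [half_subgraph_union]. *)
Definition contraction_adj : rel contraction_carrier :=
  fun u v => hamming (val u) (val v) == 1.

Lemma contraction_adj_sym : symmetric contraction_adj.
Proof. by move=> u v; rewrite /contraction_adj hamming_sym. Qed.

Lemma contraction_adj_irrefl : irreflexive contraction_adj.
Proof. by move=> u; rewrite /contraction_adj hammingxx. Qed.

Lemma half_behead x : half (f x ord0) (cube_behead (f x)).
Proof. by apply/asboolP; exists x; exact: cube_cons_eta. Qed.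

Lemma half_vertex b u : half b u -> half false u || half true u.
Proof. by case: b => ->; rewrite ?orbT. Qed.

Lemma contraction_nonempty : inhabited contraction_carrier.
Proof.
have [x] := vertex_nonempty G.
by exists; exists (cube_behead (f x)); exact: half_vertex (half_behead x).
Qed.

Definition contraction : sgraph :=
  SGraph contraction_adj_sym contraction_adj_irrefl contraction_nonempty.

Lemma half_or (u : contraction) b : half b (val u) \/ half (~~ b) (val u).
Proof. by case: u b => u /= /orP[] uh []; [right|left|left|right]. Qed.

(** Words in a common half are handled by [half_same]. Otherwise [half_cross] either gives the step
    or puts [u] in the half of [v]. *)
Lemma contraction_embedding : cube_embedding (fun u : contraction => val u).
Proof.
apply: cube_embedding_from_steps => [u v /eqP->//|u v uv].
have [b ub] : exists b, half b (val u).
  by have [ub|ub] := half_or u false; [exists false|exists true].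
suff [d [w [dw uw wv]]] : exists d w, [/\ half d w, hamming (val u) w = 1
    & hamming w (val v) < hamming (val u) (val v)].
  by exists (exist _ w (half_vertex dw)) => //; apply/eqP.
have {}uv : val u <> val v by move/val_inj.
have [vb|vb] := half_or v b.
  by have [w ?] := half_same ub vb uv; exists b, w.
have [ub'|[w ?]] := half_cross ub vb; last by exists b, w.
by have [w ?] := half_same ub' vb uv; exists (~~ b), w.
Qed.

Section Halves.
Variable b : bool.

Definition half_edge : rel contraction :=
  fun u v => [&& adj u v, half b (val u) & half b (val v)].

Lemma half_edge_sym : symmetric half_edge.
Proof. by move=> u v; rewrite /half_edge adj_sym [_ && half b (val v)]andbC. Qed.

Lemma half_edge_adj u v : half_edge u v -> adj u v.
Proof. by case/and3P. Qed.

Lemma half_edge_vertex u v : half_edge u v -> half b (val u) && half b (val v).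
Proof. by case/andP. Qed.

Hypothesis fb : exists x, f x ord0 = b.

Lemma half_nonempty : exists u : contraction, half b (val u).
Proof.
have [x fx] := fb; have xh := half_behead x.
by exists (exist _ (cube_behead (f x)) (half_vertex xh)); rewrite /= -[X in half X]fx.
Qed.

Definition half_subgraph : subgraph contraction :=
  Subgraph half_edge_sym half_edge_adj half_edge_vertex half_nonempty.

(** The steps of [half_same] never leave the half, so the local criterion holds inside it. *)
Lemma half_subgraph_isometric : isometric_subgraph half_subgraph.
Proof.
apply/(cube_embedding_isometry contraction_embedding).
apply: cube_embedding_from_steps => [u v /half_edge_adj/eqP->//|u v uv].
have [|w [bw uw wv]] := half_same (valP u) (valP v).
  by move=> /val_inj/val_inj.
exists (exist _ (exist _ w (half_vertex bw)) bw) => //.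
by apply/and3P; split=> //; [apply/eqP|exact: (valP u)].
Qed.

End Halves.

Hypotheses (f0 : exists x, f x ord0 = false) (f1 : exists x, f x ord0 = true).

Lemma half_subgraph_union : is_union (half_subgraph f0) (half_subgraph f1).
Proof.
split=> [u|u v]; first exact: (valP u).
apply/idP/idP => [uv|]; last by case/orP => /half_edge_adj.
rewrite /sub_edge /= /half_edge uv /=.
(* It remains to exclude an edge whose ends share no half. A step from [u] strictly closer to its
   neighbour [v] can only reach [v] itself. *)
suff cross b : half b (val u) -> half (~~ b) (val v) ->
    half (~~ b) (val u) || half b (val v).
  move: (valP u) (valP v) (cross false) (cross true) => /=.
  case: (half false _) (half true _) (half false _) (half true _) => [] [] [] [] //=;
    by [move=> _ _ /(_ isT isT)|move=> _ _ _ /(_ isT isT)].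
move=> ub vb; have [->//|[w [bw _]]] := half_cross ub vb.
by rewrite (eqP uv) ltnS leqn0 => /eqP/hamming0_eq <-; rewrite bw orbT.
Qed.

(** The labels of the expansion are the words [cube_cons b u] with [u] in [half b], which are
    exactly the labels of [G]. *)
Lemma contraction_expansion : is_expansion contraction G.
Proof.
split; first exact: cube_embedding_connected contraction_embedding.
exists (half_subgraph f0), (half_subgraph f1).
have I0 : isometric_subgraph (half_subgraph f0) by exact: half_subgraph_isometric.
have I1 : isometric_subgraph (half_subgraph f1) by exact: half_subgraph_isometric.
split=> //; first exact: half_subgraph_union.
apply: (cube_embedding_isomorphic
  (expansion_label_embedding I0 I1 half_subgraph_union contraction_embedding) fE).
  by case=> u; have /asboolP[x fx] := valP u; exists x.
move=> x; rewrite (cube_cons_eta (f x)).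
have xh := half_behead x.
pose v : contraction := exist _ (cube_behead (f x)) (half_vertex xh).
have vh : half (f x ord0) (val v) by [].
case: (f x ord0) vh => vh.
  by exists (inr (exist _ v vh : half_subgraph f1)).
by exists (inl (exist _ v vh : half_subgraph f0)).
Qed.

End Contraction.

(** Only [m <= n] can be claimed, because a letter that never varies is deleted without an
    expansion. *)
Lemma cube_embeddable_obtained n (G : sgraph) : cube_embeddable n G ->
  exists2 m, m <= n & obtained_from_K1 m G.
Proof.
elim: n G => [|n IH] G [f fE].
  exists 0 => //; apply: obtained_K1.
  have [x0] := vertex_nonempty G.
  have f0 (x y : G) : x = y.
    by apply: (cube_embedding_inj fE); apply/ffunP; case.
  exists (fun=> x0) => [|x y]; last by rewrite adj_irrefl.
  by exists (fun=> tt) => [[]|x].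
have [fb|] := pselect (forall b, exists x, f x ord0 = b); last first.
  (* The value [b] is never taken, so the first letter is constant and contributes nothing to
     Hamming distances. *)
  move=> /existsNP[b /forallNP fb].
  have [|m mn Gm] := IH G; last by exists m => //; exact: leqW.
  exists (fun x => cube_behead (f x)) => x y.
  have := fE x y; rewrite {1}(cube_cons_eta (f x)) {1}(cube_cons_eta (f y)) hamming_cons.
  suff -> : f x ord0 = f y ord0 by rewrite eqxx.
  by case: (f x ord0) (f y ord0) (b) (fb x) (fb y) => [] [] [].
have [|m mn Hm] := IH (contraction f); last first.
  by exists m.+1 => //; apply: obtained_expansion Hm _; exact: contraction_expansion.
by exists (fun u => val u); exact: contraction_embedding.
Qed.

(** * Hypercubes *)

Lemma in_symdiff (X : choiceType) (P Q : {fset X}) a :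
  (a \in symdiff P Q) = ((a \in P) != (a \in Q)).
Proof. by rewrite !inE; case: (a \in P); case: (a \in Q). Qed.

Lemma hypercube_dist (X : choiceType) (P Q : hypercube X) :
  dist P Q #|` symdiff P Q|.
Proof.
move: P Q; apply: dist_from_steps => [P|P Q Z /eqP PZ|P Q PQ].
- by rewrite /symdiff fsetDv fsetU0 cardfs0.
- rewrite -add1n -PZ.
  apply: leq_trans (fsubset_leq_card _) (_ : #|` symdiff P Z `|` symdiff Z Q| <= _)%fset.
    apply/fsubsetP => a; rewrite in_fsetU !in_symdiff.
    by case: (a \in P); case: (a \in Z); case: (a \in Q).
  by rewrite cardfsU leq_subr.
have [a aPQ] : exists a, a \in symdiff P Q.
  apply/fset0Pn/eqP => /fsetP PQ0; apply: PQ; apply/fsetP => a.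
  by have := PQ0 a; rewrite in_symdiff inE => /negbFE/eqP.
(* Toggling membership of one element [a] of the symmetric difference is the descending step. *)
have aZ b : (b \in symdiff P [fset a]%fset) = ((b == a) (+) (b \in P)).
  by rewrite in_symdiff in_fset1; case: (b == a); case: (b \in P).
exists (symdiff P [fset a]%fset).
  apply/eqP; rewrite -(cardfs1 a); congr #|` _|; apply/fsetP => b.
  by rewrite in_symdiff aZ in_fset1; case: (b == a); case: (b \in P).
rewrite [X in _ < X](cardfsD1 a) aPQ add1n ltnS; apply: fsubset_leq_card.
apply/fsubsetP => b; rewrite in_fsetD1 in_symdiff aZ.
move: aPQ; rewrite !in_symdiff; have [->|_] := eqVneq b a.
  by case: (a \in P); case: (a \in Q).
by case: (b \in P); case: (b \in Q).
Qed.

Definition indicator (X : choiceType) (s P : {fset X}) : cube #|{: s}| :=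
  [ffun i => val (enum_val i) \in P].

Lemma hamming_indicator (X : choiceType) (s P Q : {fset X}) :
    (P `<=` s)%fset -> (Q `<=` s)%fset ->
  hamming (indicator s P) (indicator s Q) = #|` symdiff P Q|.
Proof.
move=> Ps Qs.
under [LHS]eq_bigr do rewrite !ffunE.
(* The sum over positions becomes a sum over [s], then shrinks to the symmetric difference, outside
   which the terms vanish. *)
rewrite -(big_enum_val (fun a : s => ((val a \in P) != (val a \in Q)) : nat)).
rewrite -(big_seq_fsetE _ s xpredT (fun a => ((a \in P) != (a \in Q)) : nat)) /=.
under eq_bigr do rewrite -in_symdiff.
have sPQ : (symdiff P Q `<=` s)%fset.
  apply/fsubsetP => a; rewrite in_symdiff; have := fsubsetP Ps a; have := fsubsetP Qs a.
  by case: (a \in P); case: (a \in Q) => //.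
rewrite card_fset_sum1 -(big_fset_incl _ sPQ) => [|a _ /negbTE -> //].
by apply: eq_big_seq => a ->.
Qed.

(** Even for infinite [X], the finitely many finite sets used as labels have a finite union [s],
    whose elements serve as letters. *)
Lemma hypercube_cube_embeddable (G : sgraph) (X : choiceType) :
    finite_graph G -> isometrically_embeddable G (hypercube X) ->
  exists s : {fset X}, cube_embeddable #|` s| G.
Proof.
move=> /finite_fsetP[V VE] [f fI].
pose s := (\bigcup_(x <- V) f x)%fset; exists s.
have fs x : (f x `<=` s)%fset.
  by apply: bigfcup_sup => //; have : [set` V]%classic x by rewrite -VE.
rewrite cardfE; exists (fun x => indicator s (f x)) => x y.
by rewrite hamming_indicator //; apply/fI; exact: hypercube_dist.
Qed.

Lemma cube_embeddable_hypercube n (G : sgraph) :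
  cube_embeddable n G -> isometrically_embeddable G (hypercube 'I_n).
Proof.
move=> [f fE]; pose P x := [fset i in [pred i | f x i]]%fset.
have PE x y : #|` symdiff (P x) (P y)| = hamming (f x) (f y).
  rewrite /hamming -big_mkcond sum1_card -card_finset; congr #|` _|.
  by apply/fsetP => i; rewrite in_symdiff !inE.
exists P => x y k.
have fxy := fE x y; have Pxy := @hypercube_dist _ (P x) (P y).
rewrite PE in Pxy.
by split=> xy; [rewrite (dist_uniq xy fxy)|rewrite (dist_uniq xy Pxy)].
Qed.

(** * Finite partial cubes and their dimension *)

Lemma partial_cube_embeddable (G : sgraph) : finite_graph G ->
  partial_cube G <-> exists n, cube_embeddable n G.
Proof.
move=> finG; split=> [[X /(hypercube_cube_embeddable finG)[s sG]]|[n nG]].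
  by exists #|` s|.
by exists 'I_n; exact: cube_embeddable_hypercube.
Qed.

Theorem corollary8p2 (G : sgraph) (finG : finite_graph G) :
  (connected G ->
     (partial_cube G <-> exists n : nat, obtained_from_K1 n G)) /\
  (partial_cube G ->
     exists d : nat, isometric_dimension G d /\ expansion_number G d).
Proof.
split=> [_|].
  rewrite (partial_cube_embeddable finG); split=> -[n].
    by move=> /cube_embeddable_obtained[m _ mG]; exists m.
  by move=> /obtained_cube_embeddable nG; exists n.
move=> /(partial_cube_embeddable finG)[n nG].
have [d /asboolP dG mind] :=
  ex_minnP (ex_intro (fun n => `[< cube_embeddable n G >]) n (asboolT nG)).
have {}mind m : cube_embeddable m G -> d <= m by move=> mG; exact/mind/asboolP.
exists d; split; split.
- exists 'I_d; split; first by rewrite card_eq_sym; exact: card_II.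
  exact: cube_embeddable_hypercube.
(* A finite subset [s] of [X] already has at least [d] elements. *)
- move=> X /(hypercube_cube_embeddable finG)[s /mind ds].
  apply: card_le_trans (subset_card_le (@subsetT _ [set` s]%classic)).
  have /card_eq_fsetP/card_le_eqr-> : #|` s| = #|` s| by [].
  by rewrite card_le_II.
(* The [m <= d] expansions give back words of length [m], so minimality of [d] forces [d = m]. *)
- have [m md mG] := cube_embeddable_obtained dG.
  suff -> : d = m by [].
  by apply/eqP; rewrite eqn_leq md mind //; exact: obtained_cube_embeddable.
- by move=> m /obtained_cube_embeddable/mind.
Qed.
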